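(* (Uniform version.) Let $\binom{[n]}{2k}$ be the space of $2k$-subsets of $[n]$, where $n\le 4k-1$. If $\mathcal F\subseteq\binom{[n]}{2k}$ is a family of subsets which does not contain three distinct subsets whose symmetric difference is empty, then $|\mathcal F|\le\binom{n-1}{2k-1}$. This bound is sharp, as, for example, the family of all subsets (in $\binom{[n]}{2k}$) containing the element $1$ satisfies the condition and contains $\binom{n-1}{2k-1}$ subsets. ($p$-biased version.) Let $\{0,1\}^n$ be the space of $\{0,1\}$-vectors of length $n$ endowed with the $p$-biased measure $\mu$, where $1/2\le p\le 2/3$. If $\mathcal F\subseteq\{0,1\}^n$ is a family of vectors which does not contain three distinct vectors whose sum is zero, then $\mu(\mathcal F)\le p$. This bound is sharp, as, for example, the set of all vectors having $1$ as their first coordinate satisfies the condition and has measure $p$.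
   Context: Here $[n]=\{1,\dots,n\}$, and the symmetric difference of three sets $A,B,C$ is $A\triangle B\triangle C$; it is empty exactly when every element of $[n]$ belongs to an even number of the sets $A,B,C$. The $p$-biased measure on $\{0,1\}^n$ is $\mu(\mathcal F)=\sum_{x\in\mathcal F}p^{|x|}(1-p)^{n-|x|}$, where $|x|$ is the number of coordinates of $x$ equal to $1$. Vectors in $\{0,1\}^n$ are added coordinatewise modulo $2$.
   Formalization: The uniform bound is stated only when n ≤ 2k or n ≥ 3k (for 2k<n<3k the family of all 2k-subsets violates it); the p-biased bound is stated for families not containing the zero vector (the vectors with first coordinate 1, together with 0, violate it). *)

(* Defs.v *)
From mathcomp Require Import all_boot all_order all_algebra.

Set Implicit Arguments.
Unset Strict Implicit.
Unset Printing Implicit Defensive.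

Import GRing.Theory.
Local Open Scope ring_scope.

(* The ground set [n] = {1, ..., n} is 'I_n, shifted by one: the element 1 of
   [n] (and the first coordinate of a vector) is the ordinal of value 0. *)

Definition symdiff (T : finType) (A B : {set T}) : {set T} :=
  (A :\: B) :|: (B :\: A).

Definition ksubsets (n m : nat) : {set {set 'I_n}} :=
  [set A : {set 'I_n} | #|A| == m].

Definition symdiff_triple_free (n : nat) (F : {set {set 'I_n}}) : Prop :=
  ~ exists A B C : {set 'I_n},
      [/\ A \in F, B \in F, C \in F, uniq [:: A; B; C]
        & symdiff (symdiff A B) C = set0].

Definition star (n m : nat) (i : 'I_n) : {set {set 'I_n}} :=
  [set A in ksubsets n m | i \in A].

(* {0,1}^n is 'rV['F_2]_n, whose addition is coordinatewise modulo 2. *)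

Definition hweight (n : nat) (x : 'rV['F_2]_n) : nat :=
  #|[set i : 'I_n | x 0 i == 1]|.

Definition biased_measure (R : realFieldType) (n : nat) (p : R)
    (F : {set 'rV['F_2]_n}) : R :=
  \sum_(x in F) p ^+ hweight x * (1 - p) ^+ (n - hweight x).

Definition zero_sum_triple_free (n : nat) (F : {set 'rV['F_2]_n}) : Prop :=
  ~ exists x y z : 'rV['F_2]_n,
      [/\ x \in F, y \in F, z \in F, uniq [:: x; y; z] & x + y + z = 0].

Definition dictator (n : nat) (i : 'I_n) : {set 'rV['F_2]_n} :=
  [set x : 'rV['F_2]_n | x 0 i == 1].

(* Main.v *)
Require Import Defs.
From mathcomp Require Import all_boot all_order all_fingroup all_algebra all_field.
From mathcomp Require Import spectral ring lra zify.

Set Implicit Arguments.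
Unset Strict Implicit.
Unset Printing Implicit Defensive.

Import Order.TTheory GRing.Theory Num.Theory.
Local Open Scope ring_scope.

(** Both bounds come from a Hoffman argument for 3-uniform hypergraphs.  Take a
    reversible random walk whose stationary measure is the given one and in
    which, from x, the steps to y and to x + y are equally likely.  If F has no
    zero-sum triple and x is in F, the involution y -> x + y maps the
    neighbours of x in F to neighbours outside F, so a step from x lands in F
    with probability at most 1/2.  On the other hand, if all eigenvalues of the
    walk on nonconstant functions are at least t, a set F of measure m carries
    a step with both ends in F with probability at least m^2 + t (m - m^2).
    When F is nonempty, comparing with m / 2 gives m <= (1/2 - t) / (1 - t).

    On the cube the walk is a product: in each coordinate the triple
    (x, y, x + y) is 000 with probability 1 - 3p/2, which needs p <= 2/3, and
    one of 011, 101, 110 with probability p/2 each.  The eigenvalues are the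
    powers of t = (1 - 2p) / (2 (1 - p)), and -1 <= t <= 0 because
    1/2 <= p <= 2/3; so the least one on nonconstant functions is at least t,
    and (1/2 - t) / (1 - t) = p.  The two halves are [cube_hoffman] and
    [cube_link_half].

    On the 2k-subsets of an n-set, put m = n - 2k, so that k <= m < 2k when
    3k <= n < 4k, and walk from A to a uniform B with |A :&: B| = k; then the
    symmetric difference of A and B again is such a set.  The value
    t = - (2k - m) / (2m) makes (1/2 - t) / (1 - t) equal to 2k / n, and the
    work is to show that no eigenvalue on nonconstant functions is smaller.
    This leaves no slack: at n = 4k - 1 the first two levels of nonconstant
    eigenfunctions have the same eigenvalue when k >= 2.

    - Subtracting from an eigenfunction its image under a transposition keeps
      the eigenvalue.  After doing so for as many disjoint transpositions
      (x y) as possible, the result is, up to a scalar, the product of the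
      factors [x in B] - [y in B] ([antisymmetric_determined]).  Hence every
      eigenvalue is the sum of such a product over the neighbours of a set A
      containing each x and no y ([eigenvalue_pair_sign]), and the spectral
      theorem reduces the Hoffman inequality to lower bounds on these sums
      ([psd_of_pair_sums]).
    - As 2 ([x in B] - [y in B]) = (-1)^[y in B] - (-1)^[x in B], each sum is an
      average of sums of (-1)^|B :&: Z|, that is, of products of two Krawtchouk
      coefficients ([sum_overlap_sign]).  The coefficient coming from A, where
      exactly half of the elements is selected, vanishes whenever |A :&: Z| is
      odd, and the other products are at most that of the first level in
      absolute value ([kraw_prod_bound]).  The vanishing terms supply the
      factor 1/2 that makes the first level extremal ([sign_sum_small]).
    - When the pairs exhaust the complement of A this estimate fails, but then
      few terms of the sum are nonzero ([sign_sum_full]).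

    If n <= 2k there is at most one 2k-subset, and the bound is immediate. *)

(** * The biased cube *)

Lemma F2_cases (a : 'F_2) : (a = 0) \/ (a = 1).
Proof. by case: a => [[|[|//]] h]; [left|right]; apply/val_inj. Qed.

Lemma sum_F2 (R : nmodType) (f : 'F_2 -> R) : \sum_a f a = f 0 + f 1.
Proof.
rewrite (bigD1 (0 : 'F_2)) //= (bigD1 (1 : 'F_2)) //= big1 ?addr0 //.
by move=> a /andP[]; case: (F2_cases a) => ->.
Qed.

Lemma sum_row_prod (R : comPzSemiRingType) (T : finType) n (f : 'I_n -> T -> R) :
  \sum_(x : 'rV[T]_n) \prod_i f i (x 0 i) = \prod_i \sum_a f i a.
Proof.
rewrite bigA_distr_bigA.
rewrite (reindex (fun g : {ffun 'I_n -> T} => \row_i g i)) /=.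
  by apply: eq_bigr => g _; apply: eq_bigr => i _; rewrite mxE.
exists (fun x : 'rV[T]_n => [ffun i => x 0 i]) => [g _ | x _].
  by apply/ffunP => i; rewrite ffunE mxE.
by apply/rowP => i; rewrite mxE ffunE.
Qed.

Section Biased.
Variables (R : realFieldType) (p : R).

Definition bit_weight (a : 'F_2) : R := if a == 1 then p else 1 - p.
(** The weight times the normalised character of a biased bit is [bit_sign] times
    the square root of p (1 - p); leaving that root out keeps the computation in
    R. *)
Definition bit_sign (a : 'F_2) : R := if a == 1 then 1 else -1.

(** The joint law of two p-biased bits with correlation t, in diagonal form. *)
Definition bit_joint (t : R) (a b : 'F_2) : R :=
  bit_weight a * bit_weight b + t * (p * (1 - p)) * (bit_sign a * bit_sign b).

Definition cube_weight n (x : 'rV['F_2]_n) : R := \prod_i bit_weight (x 0 i).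
Definition cube_joint n (t : R) (x y : 'rV['F_2]_n) : R :=
  \prod_i bit_joint t (x 0 i) (y 0 i).

(** The unnormalised Fourier coefficient of the indicator of F at J. *)
Definition cube_coef n (F : {set 'rV['F_2]_n}) (J : {set 'I_n}) : R :=
  \sum_(x in F) \prod_i (if i \in J then bit_sign (x 0 i) else bit_weight (x 0 i)).

Lemma biased_measureE n (F : {set 'rV['F_2]_n}) :
  biased_measure p F = \sum_(x in F) cube_weight x.
Proof.
apply: eq_bigr => x _; rewrite /cube_weight /hweight.
rewrite (bigID (fun i => x 0 i == 1)) /=; congr (_ * _).
  rewrite (eq_bigr (fun=> p)) => [|i xi]; last by rewrite /bit_weight xi.
  by rewrite prodr_const; congr (_ ^+ _); apply: eq_card => i; rewrite inE.
rewrite (eq_bigr (fun=> 1 - p)) => [|i xi]; last by rewrite /bit_weight (negPf xi).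
rewrite prodr_const; congr (_ ^+ _).
rewrite -[X in (X - _)%N]card_ord -(cardsC [set i | x 0 i == 1]) addKn.
by apply: eq_card => i; rewrite !inE.
Qed.

Lemma sum_bit_joint t a : \sum_b bit_joint t a b = bit_weight a.
Proof.
by rewrite sum_F2 /bit_joint /bit_weight /bit_sign /=; case: eqP => _; ring.
Qed.

Lemma sum_cube_joint n t (x : 'rV['F_2]_n) :
  \sum_y cube_joint t x y = cube_weight x.
Proof.
rewrite (sum_row_prod (fun i b => bit_joint t (x 0 i) b)).
by apply: eq_bigr => i _; rewrite sum_bit_joint.
Qed.

(** At correlation 1 the two vectors coincide; this turns the measure of F into
    the sum at t = 1, comparable with the sums at other t. *)
Lemma cube_joint_diag n (x y : 'rV['F_2]_n) :
  cube_joint 1 x y = if x == y then cube_weight x else 0.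
Proof.
have bitE a b : bit_joint 1 a b = if a == b then bit_weight a else 0.
  rewrite /bit_joint /bit_weight /bit_sign.
  by case: (F2_cases a) => ->; case: (F2_cases b) => -> /=; ring.
case: eqVneq => [-> | ].
  by apply: eq_bigr => i _; rewrite bitE eqxx.
move=> nxy; have [i xyi] : exists i, x 0 i != y 0 i.
  apply/existsP; apply: contraNT nxy; rewrite negb_exists => /forallP xy.
  by apply/eqP/rowP => i; apply/eqP; rewrite -[_ == _]negbK xy.
by rewrite /cube_joint (bigD1 i) //= bitE (negPf xyi) mul0r.
Qed.

(** Expanding the product over coordinates diagonalises the walk: the
    character indexed by J has eigenvalue t ^+ #|J|. *)
Lemma cube_joint_char n t (F : {set 'rV['F_2]_n}) :
  \sum_(x in F) \sum_(y in F) cube_joint t x y =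
  \sum_(J : {set 'I_n}) t ^+ #|J| * ((p * (1 - p)) ^+ #|J| * cube_coef F J ^+ 2).
Proof.
have jointE x y : cube_joint t x y = \sum_(J : {set 'I_n})
    t ^+ #|J| * ((p * (1 - p)) ^+ #|J| *
    ((\prod_i (if i \in J then bit_sign (x 0 i) else bit_weight (x 0 i)))
     * \prod_i (if i \in J then bit_sign (y 0 i) else bit_weight (y 0 i)))).
  rewrite /cube_joint.
  under eq_bigr => i _ do rewrite /bit_joint addrC.
  rewrite bigA_distr; apply: eq_bigr => J _.
  rewrite [RHS]mulrA -exprMn.
  rewrite -prodr_const (big_mkcond (mem J)) -!big_split /=.
  by apply: eq_bigr => i _; case: ifP => _; ring.
under eq_bigr => x _ do under eq_bigr => y _ do rewrite jointE.
under eq_bigr => x _ do rewrite exchange_big /=.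
rewrite exchange_big /=; apply: eq_bigr => J _.
rewrite /cube_coef expr2 mulr_suml !mulr_sumr; apply: eq_bigr => x _.
by rewrite !mulr_sumr.
Qed.

(** Since -1 <= t <= 0, every nontrivial eigenvalue t ^+ #|J| is at least t. *)
Lemma cube_hoffman n (t : R) (F : {set 'rV['F_2]_n}) :
  0 <= p <= 1 -> -1 <= t <= 0 ->
  t * biased_measure p F + (1 - t) * biased_measure p F ^+ 2 <=
  \sum_(x in F) \sum_(y in F) cube_joint t x y.
Proof.
move=> /andP[p0 p1] /andP[t1 t0].
have diag : biased_measure p F = \sum_(x in F) \sum_(y in F) cube_joint 1 x y.
  rewrite biased_measureE; apply: eq_bigr => x xF.
  rewrite (bigD1 x) //= cube_joint_diag eqxx big1 ?addr0 // => y /andP[_ yx].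
  by rewrite cube_joint_diag eq_sym (negPf yx).
have const : biased_measure p F = cube_coef F set0.
  rewrite biased_measureE; apply: eq_bigr => x _.
  by apply: eq_bigr => i _; rewrite inE.
have t_le k : t <= t ^+ k.+1.
  case: (boolP (odd k)) => ok.
    by apply: le_trans t0 _; rewrite exprn_even_ge0 //= ok.
  rewrite -[k]odd_double_half (negPf ok) add0n exprS -mul2n exprM.
  by rewrite ler_niMr // exprn_ile1 ?sqr_ge0 //; nra.
rewrite {1}diag !cube_joint_char (bigD1 set0) //= [in leRHS](bigD1 set0) //=.
rewrite cards0 !expr0 !mul1r -const.
set m2 := _ ^+ 2; pose energy (J : {set 'I_n}) := (p * (1 - p)) ^+ #|J| * cube_coef F J ^+ 2.
suff : t * (\sum_(J | J != set0) 1 ^+ #|J| * energy J) <=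
       \sum_(J | J != set0) t ^+ #|J| * energy J by rewrite /energy; lra.
rewrite mulr_sumr; apply: ler_sum => J J0; rewrite expr1n mul1r.
apply: ler_wpM2r.
  by rewrite mulr_ge0 ?sqr_ge0 // exprn_ge0 // mulr_ge0 // subr_ge0.
by case: #|J| (card_gt0 J) => [|k _]; rewrite ?t_le // J0.
Qed.

End Biased.

Lemma oppr_F2 (a : 'F_2) : - a = a.
Proof. by case: (F2_cases a) => ->; apply/val_inj. Qed.

Lemma row_F2_addrr n (x : 'rV['F_2]_n) : x + x = 0.
Proof. by apply/rowP => i; rewrite !mxE -{1}[x 0 i]oppr_F2 addNr. Qed.

Section BiasedBound.
Variables (R : realFieldType) (p : R).
(** The correlation for which the third vector x + y is again p-biased. *)
Definition link_eigenvalue : R := (1 - 2%:R * p) / (2%:R * (1 - p)).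
Local Notation lam := link_eigenvalue.

Lemma bit_joint_link a b : p <= 2%:R / 3%:R ->
  bit_joint p lam a b =
  if (a == 0) && (b == 0) then 1 - 3%:R / 2%:R * p else p / 2%:R.
Proof.
move=> p_le.
rewrite /bit_joint /bit_weight /bit_sign /link_eigenvalue.
have p1 : 1 - p != 0 by rewrite gt_eqF //; lra.
by case: (F2_cases a) => ->; case: (F2_cases b) => -> /=; field.
Qed.

Lemma cube_joint_ge0 n (x y : 'rV['F_2]_n) :
  1 / 2%:R <= p -> p <= 2%:R / 3%:R ->
  0 <= cube_joint p lam x y.
Proof.
move=> p_ge p_le; apply: prodr_ge0 => i _; rewrite bit_joint_link //.
by case: ifP => _; lra.
Qed.

(** At this correlation 01, 10 and 11 are equally likely, so that the joint
    weight is the same for (x, y) and (x, x + y). *)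
Lemma cube_joint_shift n (x y : 'rV['F_2]_n) : p <= 2%:R / 3%:R ->
  cube_joint p lam x (x + y) = cube_joint p lam x y.
Proof.
move=> p_le; apply: eq_bigr => i _; rewrite !bit_joint_link // mxE.
by case: (F2_cases (x 0 i)) => ->; rewrite ?add0r.
Qed.

(** The translation by x preserves the steps leaving x and moves those ending in
    F outside F; so F receives at most half of their weight. *)
Lemma cube_link_half n (F : {set 'rV['F_2]_n}) (x : 'rV['F_2]_n) :
  1 / 2%:R <= p -> p <= 2%:R / 3%:R ->
  0 \notin F -> zero_sum_triple_free F -> x \in F ->
  2%:R * \sum_(y in F) cube_joint p lam x y <= cube_weight p x.
Proof.
move=> p_ge p_le F0 Ffree xF.
have shiftK : involutive (fun y => x + y).
  by move=> y; rewrite addrA row_F2_addrr add0r.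
have shiftF y : y \in F -> x + y \notin F.
  move=> yF; apply/negP => xyF; apply: Ffree; exists x, y, (x + y); split => //.
    have nz z : z \in F -> z != 0 by apply: contraTneq => ->.
    rewrite /= !inE !andbT negb_or -andbA; apply/and3P; split.
    - by apply: contraNneq (nz _ xyF) => ->; rewrite row_F2_addrr.
    - by rewrite -subr_eq0 opprD addrA subrr add0r oppr_eq0 nz.
    - by rewrite -subr_eq0 opprD addrCA subrr addr0 oppr_eq0 nz.
  exact: row_F2_addrr.
rewrite -(sum_cube_joint p lam x) [leRHS](bigID (mem F)) /= mulr_natl mulr2n lerD2l.
rewrite (reindex_inj (inv_inj shiftK)) /=.
under eq_bigr => y _ do rewrite cube_joint_shift //.
rewrite [leRHS](bigID (fun y => x + y \in F)) /=.
apply: ler_wpDr; first by apply: sumr_ge0 => y _; apply: cube_joint_ge0.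
rewrite [leRHS](eq_bigl (fun y => x + y \in F)) // => y /=.
apply/andP/idP => [[] // | xyF]; split=> //.
by rewrite -(shiftK y); apply: shiftF.
Qed.

Lemma biased_bound n (F : {set 'rV['F_2]_n}) :
  1 / 2%:R <= p -> p <= 2%:R / 3%:R ->
  0 \notin F -> zero_sum_triple_free F -> biased_measure p F <= p.
Proof.
move=> p_ge p_le F0 Ffree.
have p1 : 0 < 1 - p by lra.
have lamE : lam * (2%:R * (1 - p)) = 1 - 2%:R * p.
  by rewrite /link_eigenvalue mulfVK // mulf_neq0 ?pnatr_eq0 // gt_eqF.
have lam_int : -1 <= lam <= 0 by apply/andP; split; nra.
have p_int : 0 <= p <= 1 by apply/andP; split; lra.
have hoff := @cube_hoffman R p n lam F p_int lam_int.
have : 2%:R * \sum_(x in F) \sum_(y in F) cube_joint p lam x y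
        <= biased_measure p F.
  by rewrite biased_measureE mulr_sumr; apply: ler_sum => x; apply: cube_link_half.
have : 0 <= biased_measure p F.
  rewrite biased_measureE; apply: sumr_ge0 => x _; apply: prodr_ge0 => i _.
  by rewrite /bit_weight; case: ifP => _; lra.
move: (biased_measure p F) (\sum_(x in F) _) hoff => m e hoff m0 em.
(* cleared of its denominator, 1/2 - lam - (1 - lam) m is p - m *)
have : 0 <= m * (1/2%:R - lam - (1 - lam) * m) by nra.
move: m0; rewrite le_eqVlt => /predU1P[<- _|m0]; first by lra.
rewrite pmulr_rge0 // => h.
have c0 : 0 <= 2%:R * (1 - p) by lra.
rewrite -subr_ge0; suff <- : 2%:R * (1 - p) * (1 / 2%:R - lam - (1 - lam) * m) = p - m.
  exact: mulr_ge0.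
transitivity ((1 - p) - lam * (2%:R * (1 - p))
              - (2%:R * (1 - p) - lam * (2%:R * (1 - p))) * m); first by field.
by rewrite lamE; ring.
Qed.

End BiasedBound.

Lemma dictator_notin0 n (i : 'I_n) : 0 \notin dictator i.
Proof. by rewrite inE mxE. Qed.

Lemma dictator_triple_free n (i : 'I_n) : zero_sum_triple_free (dictator i).
Proof.
move=> [x [y [z []]]]; rewrite !inE => /eqP xi /eqP yi /eqP zi _ /rowP/(_ i).
by rewrite !mxE xi yi zi.
Qed.

Lemma dictator_measure (R : realFieldType) (p : R) n (i : 'I_n) :
  biased_measure p (dictator i) = p.
Proof.
rewrite biased_measureE.
(* the indicator of x 0 i == 1 is absorbed in the factor of index i *)
pose f j a := if (j == i) && (a == 0) then 0 else bit_weight p a.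
transitivity (\sum_(x : 'rV['F_2]_n) \prod_j f j (x 0 j)).
  rewrite big_mkcond; apply: eq_bigr => x _; rewrite inE; case: ifP => [/eqP xi|xi].
    apply: eq_bigr => j _; rewrite /f.
    by case: eqVneq => [-> | //]; rewrite xi.
  rewrite (bigD1 i) //= /f eqxx /=.
  by case: (F2_cases (x 0 i)) xi => -> // _; rewrite eqxx mul0r.
rewrite sum_row_prod (bigD1 i) //= sum_F2 [X in _ * X]big1 => [|j /negPf ji].
  by rewrite mulr1 /f eqxx /= /bit_weight /= add0r.
by rewrite sum_F2 /f ji /= /bit_weight /=; ring.
Qed.

(** * Krawtchouk coefficients *)

(** The Krawtchouk value: the sum of (-1)^|S :&: Z| over the sets S of size c in
    a set of size r + s, where Z has r elements. *)
Definition kraw (r s c : nat) : int := ((1 - 'X) ^+ r * (1 + 'X) ^+ s : {poly int})`_c.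

Lemma kraw0c r s : kraw r s 0 = 1.
Proof.
rewrite /kraw -horner_coef0 hornerM !horner_exp !hornerE /=.
by rewrite ?subr0 ?addr0 !expr1n mulr1.
Qed.

Lemma krawSr r s c : kraw r.+1 s c.+1 = kraw r s c.+1 - kraw r s c.
Proof.
by rewrite /kraw exprS -mulrA mulrBl mul1r coefB coefXM.
Qed.

Lemma krawrS r s c : kraw r s.+1 c.+1 = kraw r s c.+1 + kraw r s c.
Proof. by rewrite /kraw exprSr mulrA mulrDr mulr1 coefD coefMX. Qed.

Lemma kraw0 s c : kraw 0 s c = 'C(s, c)%:Z.
Proof.
elim: s c => [|s IHs] [|c]; rewrite ?kraw0c ?bin0 //.
  by rewrite /kraw !expr0 mulr1 coef1.
by rewrite krawrS !IHs binS PoszD.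
Qed.

Lemma krawC r s c : kraw s r c = (-1) ^+ c * kraw r s c.
Proof.
have [N] := ubnP (r + s); elim: N r s c => // N IH.
move=> [|r] s [|c] rsN; rewrite ?kraw0c ?expr0 ?mulr1 //; last first.
  rewrite krawrS krawSr (IH r s c) ?(IH r s c.+1); [|lia..].
  by rewrite exprS; ring.
case: s rsN => [|s] rsN; first by rewrite kraw0 mulr0.
by rewrite krawSr krawrS (IH 0%N s c) ?(IH 0%N s c.+1); [rewrite exprS; ring|lia..].
Qed.

Lemma kraw_gt r s c : (r + s < c)%N -> kraw r s c = 0.
Proof.
elim: r s c => [|r IHr] s [|c] //; first by rewrite kraw0 => /bin_small ->.
by move=> rsc; rewrite krawSr !IHr //; lia.
Qed.

Lemma kraw_sym r s c c' : (c + c' = r + s)%N ->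
  kraw r s c' = (-1) ^+ r * kraw r s c.
Proof.
elim: r s c c' => [|r IHr] s c c' cc'.
  by rewrite !kraw0 expr0 mul1r; congr Posz; rewrite -bin_sub; [congr 'C(_, _)|]; lia.
have top d : (d = r + s)%N -> kraw r.+1 s d.+1 = (-1) ^+ r.+1.
  move=> ->; rewrite krawSr kraw_gt // (IHr s 0%N) // kraw0c exprS; ring.
case: c c' cc' => [|c] [|c'] cc'; try lia.
- by rewrite top ?kraw0c ?mulr1 //; lia.
- by rewrite kraw0c top; [rewrite -exprMn mulrNN mulr1 expr1n|lia].
rewrite !krawSr (IHr s c.+1 c') ?(IHr s c c'.+1); [|lia..].
by rewrite exprS; ring.
Qed.

(** Complementing the selected set multiplies the value by (-1)^r but, in the
    middle, does not change c. *)
Lemma kraw_mid_odd r s c : (r + s = c.*2)%N -> odd r -> kraw r s c = 0.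
Proof.
move=> rsc ro; have := @kraw_sym r s c c; rewrite addnn rsc -signr_odd ro expr1 mulN1r.
by move=> /(_ erefl); lia.
Qed.

Lemma kraw_le_bin r s c : `|kraw r s c| <= 'C(r + s, c)%:Z.
Proof.
elim: r c => [|r IHr] [|c]; rewrite ?kraw0c ?kraw0 ?bin0 //.
rewrite krawSr addSn binS; have := IHr c; have := IHr c.+1; lia.
Qed.

(** Away from the trivial signs (r = 0 or s = 0), the first value is extremal.
    Splitting off one factor 1 + X gives an induction on r + s for both sides at
    once.  It breaks down only when c is the middle of r + s - 1, where the right
    hand side loses one of its two terms; but then the left hand side loses one as
    well, by [kraw_mid_odd], if the factor split off is chosen by the parity of
    r. *)
Lemma kraw_le r s c : (c.*2 < r.+1 + s.+1)%N ->
  `|kraw r.+1 s.+1 c| <= kraw 1 (r + s.+1) c.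
Proof.
have [N] := ubnP (r + s); elim: N r s c => // N IH r s [|c] rsN cN.
  by rewrite !kraw0c.
(* by symmetry a factor 1 + X can be split off so that one remains *)
wlog [s' es] : r s rsN cN / exists s', s = s'.+1.
  move=> wl; case: s rsN cN => [|s] rsN cN; last by apply: wl => //; exists s.
  case: r rsN cN => [|r] rsN cN.
    by have -> : c = 0%N by lia; rewrite krawrS !kraw0c /kraw !expr1 coefD.
  rewrite krawC normrM normrX normrN1 expr1n mul1r.
  have := wl 0%N r.+1; rewrite !add0n addn1; apply => //; [lia..|].
  by exists r.
subst s; have [cN' | cN'] := ltnP c.+1.*2 (r.+1 + s'.+1).
  rewrite krawrS addnS [in leRHS]krawrS.
  have := IH r s' c.+1; have := IH r s' c; lia.
have rs : (r + s' = c.*2)%N by lia.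
rewrite addnS [in leRHS]krawrS (@kraw_mid_odd 1) //; last by lia.
rewrite add0r; have [ro|re] := boolP (odd r.+1).
  rewrite krawrS (@kraw_mid_odd r.+1) //; last by lia.
  by rewrite add0r; apply: IH; lia.
rewrite krawSr (@kraw_mid_odd r) //; [|lia|by rewrite /= negbK in re].
rewrite sub0r normrN; case: r re rsN cN cN' rs => [|r] // re rsN cN cN' rs.
by rewrite addSn -addnS; apply: IH; lia.
Qed.

Lemma kraw1E m c : m.+1%:Z * kraw 1 m c = (m.+1%:Z - 2 * c%:Z) * 'C(m.+1, c)%:Z.
Proof.
case: c => [|c]; first by rewrite kraw0c bin0 mulr0 subr0.
rewrite krawSr !kraw0.
have h1 := mul_bin_diag m.+1 c.
have h2 : (m.+1 * 'C(m.+1, c.+1) = m.+1 * 'C(m, c.+1) + m.+1 * 'C(m, c))%N.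
  by rewrite -mulnDr -binS.
rewrite /= in h1; lia.
Qed.

(** In the middle the first value vanishes; the second one, C(2k, k) / (2k - 1)
    up to sign, takes its place as the extremal one. *)
Lemma kraw_mid_le r s k : (r + s = k.*2)%N -> (0 < r)%N -> (0 < s)%N ->
  (k.*2.-1)%:Z * `|kraw r s k| <= 'C(k.*2, k)%:Z.
Proof.
move=> rsk r0 s0; have [ro|re] := boolP (odd r).
  by rewrite kraw_mid_odd // normr0 mulr0.
case: k rsk => [|k] rsk; first lia.
case: s s0 rsk => // s s0 rsk; case: s s0 rsk => [|s] _ rsk; first lia.
case: r r0 re rsk => // r _ re rsk.
have le := @kraw_le r s k ltac:(lia).
rewrite krawrS (@kraw_sym r.+1 s.+1 k); last by lia.
rewrite -signr_odd (negPf re) expr0 mul1r.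
have -> : 'C(k.+1.*2, k.+1)%:Z = 2 * 'C(k.*2.+1, k)%:Z.
  have mid : 'C(k.*2.+1, k.+1) = 'C(k.*2.+1, k).
    by rewrite -bin_sub; [congr 'C(_, _)|]; lia.
  by rewrite doubleS binS mid; lia.
have := kraw1E k.*2 k.
have -> : k.*2 = (r + s.+1)%N by lia.
have -> : ((r + s.+1).+1%:Z - 2 * k%:Z) = 1 by lia.
rewrite mul1r => <-.
have -> : (k.+1.*2.-1 = (r + s.+1).+1)%N by lia.
rewrite -mulr2n normrMn; nia.
Qed.

(** With m = n - 2k, minus half of this number is the eigenvalue of the first
    level, as a sum over the neighbours of a set. *)
Definition kraw_bound k m : int := 'C(k.*2, k)%:Z * kraw 1 m.-1 (m - k).

Lemma kraw_boundE k m : (k <= m)%N -> (0 < m)%N ->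
  m%:Z * kraw_bound k m = (k.*2%:Z - m%:Z) * ('C(k.*2, k)%:Z * 'C(m, k)%:Z).
Proof.
case: m => // m km _; rewrite /kraw_bound mulrCA /= kraw1E bin_sub //.
have : ((m.+1 - k)%N)%:Z = m.+1%:Z - k%:Z by lia.
by move=> ->; rewrite -mul2n PoszM; ring.
Qed.

(** The case s = 0 is where the middle coefficient must compensate for the trivial
    one: its relative size 1 / (2k - 1) is at most the relative size (2k - m) / m
    of the bound, because m <= 2k - 1. *)
Lemma kraw_prod_bound k m r s :
  (k <= m < k.*2)%N -> (0 < r + s < m)%N ->
  `|kraw r (k.*2 - r) k * kraw s (m - s) k| <=
    if odd r then 0 else kraw_bound k m.
Proof.
move=> /andP[km m2k] /andP[rs0 rsm]; rewrite normrM.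
have [ro|re] := boolP (odd r).
  by rewrite kraw_mid_odd ?normr0 ?mul0r //; lia.
have lebin : `|kraw r (k.*2 - r) k| <= 'C(k.*2, k)%:Z.
  by have := kraw_le_bin r (k.*2 - r) k; rewrite subnKC //; lia.
case: s rs0 rsm => [|s] rs0 rsm; last first.
  apply: ler_pM => //.
  rewrite (@kraw_sym s.+1 (m - s.+1) (m - k)); last by lia.
  rewrite normrM normrX normrN1 expr1n mul1r.
  have := @kraw_le s (m - s.+1).-1 (m - k) ltac:(lia).
  have -> : (m - s.+1).-1.+1 = (m - s.+1)%N by lia.
  by have -> : (s + (m - s.+1))%N = m.-1 by lia.
rewrite subn0 kraw0.
have := @kraw_mid_le r (k.*2 - r) k ltac:(lia) ltac:(lia) ltac:(lia).
have := kraw_boundE km ltac:(lia).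
set C2 := 'C(k.*2, k)%:Z; set Cm := 'C(m, k)%:Z => mB kx.
rewrite (ger0_norm (ltac:(done) : 0 <= Cm)).
rewrite -(@ler_pM2l _ m%:Z); last by lia.
rewrite mB mulrA; have Cm0 : 0 <= Cm by [].
rewrite mulrA; apply: ler_wpM2r => //.
have : (m%:Z <= k.*2.-1%:Z) by lia.
have : 0 <= C2 by []. have : 1 <= k.*2%:Z - m%:Z by lia.
move: kx; move: (k.*2%:Z - m%:Z) => e; nia.
Qed.

Lemma bin_mid_ge k : (0 < k)%N -> (2 * k.*2.-1 <= 'C(k.*2, k))%N.
Proof.
elim: k => // -[_ _ // | k /(_ isT) IH _].
have : ('C(k.+2.*2, k.+2) =
        'C(k.+1.*2, k.+2) + 'C(k.+1.*2, k.+1).*2 + 'C(k.+1.*2, k))%N.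
  by rewrite !doubleS !binS; lia.
have : (0 < 'C(k.+1.*2, k.+2))%N by rewrite bin_gt0; lia.
have : (0 < 'C(k.+1.*2, k))%N by rewrite bin_gt0; lia.
lia.
Qed.

Lemma kraw_bound_ge k m : (k <= m < k.*2)%N -> (0 < k)%N ->
  2 * 'C(m, k)%:Z <= kraw_bound k m.
Proof.
move=> /andP[km m2k] k0; have := kraw_boundE km ltac:(lia).
have := bin_mid_ge k0.
set B := kraw_bound k m; set Cm := 'C(m, k); set C2 := 'C(k.*2, k) => C2ge mB.
rewrite -(@ler_pM2l _ m%:Z); last by lia.
rewrite mB mulrCA mulrA mulrA; apply: ler_wpM2r => //.
have : 1 <= k.*2%:Z - m%:Z by lia.
move: (k.*2%:Z - m%:Z) => e; nia.
Qed.

(** * Signed sums over sets of prescribed overlap *)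

Section Overlaps.
Variable T : finType.
Implicit Types (A B Z : {set T}) (l : seq (T * T)).

Definition overlap (a b : nat) A B := (#|A :&: B| == a) && (#|B :\: A| == b).

Lemma prod_sign_kraw A Z :
  \prod_(i in A) (1 + (if i \in Z then -1 else 1) *: 'X : {poly int}) =
  (1 - 'X) ^+ #|A :&: Z| * (1 + 'X) ^+ #|A :\: Z|.
Proof.
rewrite (bigID (mem Z)) /=; congr (_ * _).
  rewrite (eq_bigr (fun=> 1 - 'X)) => [|i /andP[_ ->]]; last by rewrite scaleN1r.
  by rewrite prodr_const; congr (_ ^+ _); apply: eq_card => i; rewrite !inE.
rewrite (eq_bigr (fun=> 1 + 'X)) => [|i /andP[_ /negPf->]]; last by rewrite scale1r.
by rewrite prodr_const; congr (_ ^+ _); apply: eq_card => i; rewrite !inE andbC.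
Qed.

(** Expand the product of the factors 1 + w_i Y (i in A) and 1 + w_i X (i not in
    A), where w_i is -1 on Z and 1 elsewhere, and compare the coefficients of
    Y^a X^b. *)
Lemma sum_overlap_sign A Z a b :
  \sum_(B | overlap a b A B) (-1) ^+ #|B :&: Z| =
  kraw #|A :&: Z| #|A :\: Z| a * kraw #|~: A :&: Z| #|~: A :\: Z| b.
Proof.
pose w i : int := if i \in Z then -1 else 1.
pose mono i : {poly {poly int}} := (w i)%:P%:P * (if i \in A then 'X%:P else 'X).
have expand : \prod_i (mono i + 1) = \sum_B
    ((-1) ^+ #|B :&: Z|)%:P%:P * (('X^#|A :&: B|)%:P * 'X^#|B :\: A|).
  rewrite bigA_distr; apply: eq_bigr => B _.
  rewrite -big_mkcond big_split /=; congr (_ * _).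
    rewrite -!rmorph_prod; congr _%:P%:P.
    rewrite -big_mkcondr /= prodr_const; congr (_ ^+ _).
    by apply: eq_card => i; rewrite !inE.
  rewrite (bigID (mem A)) /=; congr (_ * _).
    rewrite (eq_bigr (fun=> 'X%:P)) => [|i /andP[_ ->] //].
    rewrite prodr_const -rmorphXn; congr (_ ^+ _)%:P.
    by apply: eq_card => i; rewrite !inE andbC.
  rewrite (eq_bigr (fun=> 'X)) => [|i /andP[_ /negPf->] //].
  by rewrite prodr_const; congr (_ ^+ _); apply: eq_card => i; rewrite !inE andbC.
have factor : \prod_i (mono i + 1) =
    ((1 - 'X) ^+ #|A :&: Z| * (1 + 'X) ^+ #|A :\: Z|)%:P *
    ((1 - 'X) ^+ #|~: A :&: Z| * (1 + 'X) ^+ #|~: A :\: Z|)^:P.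
  rewrite -!prod_sign_kraw (bigID (mem A)) /= !rmorph_prod; congr (_ * _).
    apply: eq_bigr => i iA; rewrite /mono iA -rmorphM /= -[1]/(1%:P) -rmorphD /=.
    by rewrite mul_polyC addrC.
  apply: eq_big => [i|i /negPf iA]; first by rewrite inE.
  by rewrite /mono iA rmorphD rmorph1 /= map_polyZ map_polyX /= -mul_polyC addrC.
have := congr1 (fun q : {poly {poly int}} => (q`_b)`_a) (etrans (esym expand) factor).
rewrite !coef_sum coefCM coef_map coefMC /= => <-; rewrite big_mkcond /=.
apply: eq_bigr => B _; rewrite !coefCM coefXn /overlap andbC eq_sym.
case: eqP => _; rewrite ?mulr1 ?mulr0 ?coef0 ?coefXn 1?eq_sym ?mulr0 //=.
by case: eqP; rewrite ?mulr1 ?mulr0.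
Qed.

(** Up to a scalar, the function that is antisymmetric under each of the
    transpositions of l and invariant under the permutations of the remaining
    elements. *)
Definition pair_sign l B : int := \prod_(q <- l) ((q.1 \in B)%:R - (q.2 \in B)%:R).

Definition sign_sum k A Z l : int :=
  \sum_(B | overlap k k A B) (-1) ^+ #|B :&: Z| * pair_sign l B.

Lemma sign_sum_nil k A Z : sign_sum k A Z [::] =
  kraw #|A :&: Z| #|A :\: Z| k * kraw #|~: A :&: Z| #|~: A :\: Z| k.
Proof.
rewrite -sum_overlap_sign; apply: eq_bigr => B _.
by rewrite /pair_sign big_nil mulr1.
Qed.

Lemma sign_setU1 x Z B : x \notin Z ->
  (-1) ^+ #|B :&: (x |: Z)| = (-1) ^+ #|B :&: Z| * (1 - 2 * (x \in B)%:R) :> int.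
Proof.
move=> xZ; rewrite setIUr cardsU.
have -> : B :&: [set x] :&: (B :&: Z) = set0.
  by apply/setP => i; rewrite !inE; case: eqVneq => [->|]; rewrite ?(negPf xZ) !andbF.
rewrite cards0 subn0 exprD mulrC; congr (_ * _).
case: (boolP (x \in B)) => xB.
  by rewrite (setIidPr _) ?sub1set // cards1 expr1 mulr1.
have -> : B :&: [set x] = set0 by apply/eqP; rewrite setIC setI_eq0 disjoints1.
by rewrite cards0 mulr0 subr0.
Qed.

(** Replacing a pair by the difference of two signs trades a factor of
    [pair_sign] for one more element of Z. *)
Lemma sign_sum_cons k A Z x y l : x \notin Z -> y \notin Z ->
  2 * sign_sum k A Z ((x, y) :: l) = sign_sum k A (y |: Z) l - sign_sum k A (x |: Z) l.
Proof.
move=> xZ yZ; rewrite /sign_sum mulr_sumr -sumrB; apply: eq_bigr => B _.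
by rewrite /pair_sign big_cons /= !sign_setU1 //; ring.
Qed.

Definition splits A l :=
  [&& uniq (unzip1 l), uniq (unzip2 l)
    & all (fun q => (q.1 \in A) && (q.2 \notin A)) l].

Lemma sign_sum_nil_le k A Z : #|A| = k.*2 -> (k <= #|~: A| < k.*2)%N ->
  (0 < #|Z| < #|~: A|)%N ->
  `|sign_sum k A Z [::]| <= if odd #|A :&: Z| then 0 else kraw_bound k #|~: A|.
Proof.
move=> Ak km Zm.
have cZ : (#|Z| = #|A :&: Z| + #|~: A :&: Z|)%N.
  by rewrite -(cardsID A Z) setIC; congr (_ + #|pred_of_set _|)%N; rewrite setDE setIC.
rewrite sign_sum_nil.
have -> : #|A :\: Z| = (k.*2 - #|A :&: Z|)%N by rewrite -Ak -(cardsID Z A) addKn.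
have -> : #|~: A :\: Z| = (#|~: A| - #|~: A :&: Z|)%N.
  by rewrite -[in RHS](cardsID Z (~: A)) addKn.
by apply: kraw_prod_bound; rewrite -?cZ.
Qed.

(** Removing the last pair leaves two sums without pairs whose sets Z differ in
    the parity of |A :&: Z|, so that one of them vanishes: this gives the factor
    1/2.  Removing the other pairs only averages. *)
Lemma sign_sum_small k A Z p l : #|A| = k.*2 -> (k <= #|~: A| < k.*2)%N ->
  splits A (p :: l) ->
  (forall q, q \in p :: l -> (q.1 \notin Z) && (q.2 \notin Z)) ->
  (#|Z| + size (p :: l) < #|~: A|)%N ->
  2 * `|sign_sum k A Z (p :: l)| <= kraw_bound k #|~: A|.
Proof.
move=> Ak km; have B0 : 0 <= kraw_bound k #|~: A|.
  by apply: le_trans (@kraw_bound_ge k #|~: A| km ltac:(lia)).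
elim: l p Z => [|p' l IH] [x y] Z spl notZ sz.
  have /and3P[_ _ /= /andP[/andP[xA yA] _]] := spl.
  have /andP[/= xZ yZ] := notZ _ (mem_head _ _).
  have cx : #|x |: Z| = #|Z|.+1 by rewrite cardsU1 xZ.
  have cy : #|y |: Z| = #|Z|.+1 by rewrite cardsU1 yZ.
  have := @sign_sum_nil_le k A (x |: Z) Ak km ltac:(rewrite cx /= in sz *; lia).
  have := @sign_sum_nil_le k A (y |: Z) Ak km ltac:(rewrite cy /= in sz *; lia).
  have -> : A :&: (y |: Z) = A :&: Z.
    by apply/setP => i; rewrite !inE; case: eqVneq => [->|//]; rewrite (negPf yA).
  have -> : A :&: (x |: Z) = x |: (A :&: Z).
    by apply/setP => i; rewrite !inE; case: eqVneq => [->|//]; rewrite xA.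
  rewrite cardsU1 inE (negPf xZ) andbF add1n /=.
  have := sign_sum_cons k A [::] xZ yZ; case: (odd _) => /=; lia.
have /and3P[u1 u2 /= /andP[/andP[xA yA] inA]] := spl.
have /andP[/= xZ yZ] := notZ _ (mem_head _ _).
have spl' : splits A (p' :: l).
  by apply/and3P; split=> //; [case/andP: u1 | case/andP: u2].
have step z : z = x \/ z = y ->
    2 * `|sign_sum k A (z |: Z) (p' :: l)| <= kraw_bound k #|~: A|.
  move=> zxy; have zZ : z \notin Z by case: zxy => ->.
  apply: IH => //; last by move: sz; rewrite cardsU1 zZ addnS.
  move=> q qin; have /andP[q1 q2] := notZ q ltac:(by rewrite inE qin orbT).
  have /and3P[_ _ /allP inA'] := spl'.
  have /andP[q1A q2A] := inA' q qin.
  rewrite !inE !negb_or q1 q2 !andbT; apply/andP; case: zxy => ->; split.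
  - apply: contraTneq u1 => <-.
    by rewrite [uniq _]/= negb_and negbK; apply/orP; left; apply: (map_f fst qin).
  - by apply: contraNneq q2A => ->.
  - by apply: contraTneq q1A => ->.
  - apply: contraTneq u2 => <-.
    by rewrite [uniq _]/= negb_and negbK; apply/orP; left; apply: (map_f snd qin).
have := step x (or_introl erefl); have := step y (or_intror erefl).
have := sign_sum_cons k A (p' :: l) xZ yZ.
move: (sign_sum _ _ _ _) (sign_sum _ _ _ _) (sign_sum _ _ _ _) => a b c; clear; lia.
Qed.

Lemma pair_sign_le1 l B : `|pair_sign l B| <= 1.
Proof.
elim: l => [|q l IH]; rewrite /pair_sign ?big_nil // big_cons normrM mulr_ile1 //.
by case: (_ \in _); case: (_ \in _).
Qed.

Lemma pair_sign_neq0 l B : pair_sign l B != 0 ->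
  forall q, q \in l -> (q.1 \in B) = (q.2 \notin B).
Proof.
move=> nz q ql; apply: contraNeq nz => qB.
rewrite /pair_sign (big_rem q) //= mulf_eq0; apply/orP; left.
by move: qB; case: (q.1 \in B); case: (q.2 \in B).
Qed.

(** Every element y outside A now has a partner x in A, and in a nonzero term
    exactly one of them is in B.  So the k partners of B :\: A are all the elements
    of A outside B, and B is determined by B :\: A. *)
Lemma sign_sum_full k A l : #|A| = k.*2 ->
  splits A l -> size l = #|~: A| ->
  `|sign_sum k A set0 l| <= 'C(#|~: A|, k)%:Z.
Proof.
move=> Ak /and3P[u1 u2 /allP inA] full.
pose partners (S : {set T}) := [seq q.1 | q <- l & q.2 \in S].
have snd_all : unzip2 l =i ~: A.
  have sub : {subset unzip2 l <= enum (~: A)}.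
    by move=> y; rewrite mem_enum inE => /mapP[q ql ->]; case/andP: (inA q ql).
  have [|_ eql] := uniq_min_size u2 sub; first by rewrite -cardE size_map full.
  by move=> y; rewrite eql mem_enum.
have size_partners (S : {set T}) : S \subset ~: A -> size (partners S) = #|S|.
  move=> /subsetP SA; rewrite size_map.
  have -> : size [seq q <- l | q.2 \in S] = size (filter (mem S) (unzip2 l)).
    by rewrite filter_map size_map.
  rewrite -(card_uniqP (filter_uniq _ u2)); apply: eq_card => y.
  rewrite mem_filter snd_all /=.
  by case: (boolP (y \in S)) => [/SA ->|].
have trace B : overlap k k A B -> pair_sign l B != 0 ->
    A :\: B = [set x in partners (B :\: A)].
  move=> /andP[/eqP AB /eqP BA] nz; apply/esym/eqP; rewrite eqEcard; apply/andP; split.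
    apply/subsetP => x; rewrite inE => /mapP[q]; rewrite mem_filter => /andP[].
    rewrite inE => /andP[_ qB] ql ->; rewrite inE (pair_sign_neq0 nz) // qB.
    by case/andP: (inA q ql).
  have u : uniq (partners (B :\: A)).
    by apply: subseq_uniq u1; apply: map_subseq; apply: filter_subseq.
  have -> : #|[set x in partners (B :\: A)]| = size (partners (B :\: A)).
    by rewrite cardsE; apply/card_uniqP.
  rewrite size_partners ?BA; last by rewrite setDE subsetIr.
  by have := cardsID B A; rewrite AB Ak; lia.
apply: le_trans (ler_norm_sum _ _ _) _.
pose good := [set B | overlap k k A B & pair_sign l B != 0].
apply: (@le_trans _ _ #|good|%:Z).
  rewrite -sum1_card -natz natr_sum [leRHS]big_mkcond /= [leLHS]big_mkcond /=.
  apply: ler_sum => B _; rewrite inE; case: ifP => //= _.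
  rewrite normrM normrX normrN1 expr1n mul1r.
  by case: eqVneq => [->|_]; rewrite ?normr0 ?pair_sign_le1.
rewrite lez_nat -(cards_draws (~: A) k).
have inj : {in good &, injective (fun B => B :\: A)}.
  move=> B B'; rewrite !inE => /andP[oB nB] /andP[oB' nB'] /= eqBA.
  have eqAB : A :\: B = A :\: B' by rewrite !trace // eqBA.
  apply/setP => i; move/setP/(_ i): eqBA; move/setP/(_ i): eqAB; rewrite !inE.
  by case: (i \in A) => /=; case: (i \in B); case: (i \in B').
rewrite -(card_in_imset inj); apply: subset_leq_card; apply/subsetP => S.
move=> /imsetP[B]; rewrite !inE => /andP[/andP[_ BA] _] ->.
by rewrite BA andbT setDE subsetIr.
Qed.

Lemma sign_sum_ge k A p l : #|A| = k.*2 -> (k <= #|~: A| < k.*2)%N ->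
  splits A (p :: l) ->
  2 * sign_sum k A set0 (p :: l) >= - kraw_bound k #|~: A|.
Proof.
move=> Ak km spl.
have size_le : (size (p :: l) <= #|~: A|)%N.
  have /and3P[_ u2 /allP inA] := spl.
  rewrite -(size_map snd) -(card_uniqP u2); apply: subset_leq_card.
  by apply/subsetP => _ /mapP[q ql ->]; rewrite inE; case/andP: (inA q ql).
rewrite leq_eqVlt in size_le; have {size_le}/orP[/eqP full | small] := size_le.
  have := sign_sum_full Ak spl full.
  have := @kraw_bound_ge k #|~: A| ltac:(lia) ltac:(lia); lia.
have notin0 q : q \in p :: l -> (q.1 \notin set0) && (q.2 \notin set0).
  by rewrite !inE.
by have := sign_sum_small Ak km spl notin0; rewrite cards0 => /(_ small); lia.
Qed.
End Overlaps.

(** * Positivity of kernels invariant under transpositions *)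

Lemma sum_enum_val (R : nmodType) (T : finType) (F : T -> R) :
  \sum_A F A = \sum_(i < #|T|) F (enum_val i).
Proof.
rewrite (reindex_onto enum_val enum_rank) /=; last by move=> ? _; rewrite enum_rankK.
by apply: eq_bigl => i; rewrite enum_valK eqxx.
Qed.

(** By the spectral theorem, over the algebraic numbers: the quadratic form is the
    sum of the eigenvalues times the squared norms of coordinates. *)
Lemma psd_of_eigenvalues (T : finType) (K : T -> T -> int) :
  (forall A B, K A B = K B A) ->
  (forall (v : T -> algC) (d : algC), (exists A, v A != 0) ->
     (forall A, \sum_B (K A B)%:~R * v B = d * v A) -> 0 <= d) ->
  forall f : T -> int, 0 <= \sum_A \sum_B f A * K A B * f B.
Proof.
move=> Ksym eig f.
pose M : 'M[algC]_#|T| := \matrix_(i, j) (K (enum_val i) (enum_val j))%:~R.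
pose x : 'rV[algC]_#|T| := \row_i (f (enum_val i))%:~R.
have Mnormal : M \is normalmx.
  apply: hermitian_normalmx; apply: realsym_hermsym.
    apply/is_hermitianmxP; rewrite expr0 scale1r.
    by apply/matrixP => i j; rewrite !mxE Ksym.
  by apply/mxOverP => i j; rewrite mxE realz.
have /orthomx_spectralP Mdiag := Mnormal.
set P := spectralmx M in Mdiag; set d := spectral_diag M in Mdiag.
have Pu : P \is unitarymx := spectral_unitarymx M.
have d_ge0 i : 0 <= d 0 i.
  apply: (eig (fun A => P i (enum_rank A))).
    have : row i P != 0.
      apply: contraTneq (unitarymx_unit Pu) => Pi0.
      apply/negP => Pun; have := congr1 (fun w => w *m invmx P) Pi0.
      rewrite mul0mx -row_mul mulmxV // => /rowP/(_ i); rewrite !mxE eqxx => /eqP.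
      by rewrite oner_eq0.
    move=> /rV0Pn[j Pij]; exists (enum_val j).
    by rewrite enum_valK; rewrite mxE in Pij.
  move=> A; have : P *m M = diag_mx d *m P.
    by rewrite [in LHS]Mdiag !mulmxA mulmxV ?mul1mx // unitarymx_unit.
  move=> /matrixP/(_ i (enum_rank A)); rewrite mul_diag_mx !mxE => <-.
  rewrite sum_enum_val; apply: eq_bigr => j _.
  by rewrite !mxE enum_valK enum_rankK Ksym mulrC.
rewrite -(ler0z algC).
have <- : (x *m M *m x^T) 0 0 = (\sum_A \sum_B f A * K A B * f B)%:~R :> algC.
  rewrite mxE [in RHS]exchange_big rmorph_sum /= [RHS]sum_enum_val.
  apply: eq_bigr => j _; rewrite !mxE rmorph_sum mulr_suml /= [RHS]sum_enum_val.
  by apply: eq_bigr => i _; rewrite !mxE !rmorphM.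
pose z := x *m invmx P.
have Pxz : P *m x^T = (z ^t*)%sesqui.
  rewrite /z invmx_unitary // trmx_mul map_mxM /= trmxCK; congr (_ *m _).
  by apply/matrixP => i j; rewrite !mxE conj_intr // intr_int.
rewrite Mdiag !mulmxA -/z -mulmxA Pxz mxE; apply: sumr_ge0 => i _.
by rewrite mul_mx_diag !mxE mulrAC mulr_ge0 // mul_conjC_ge0.
Qed.

Section Swaps.
Variable T : finType.
Implicit Types (A B : {set T}) (l : seq (T * T)) (x y : T).

Definition swap x y A : {set T} := tperm x y @^-1: A.

Lemma mem_swap x y A i : (i \in swap x y A) = (tperm x y i \in A).
Proof. by rewrite inE. Qed.

Lemma swapK x y : involutive (swap x y).
Proof. by move=> A; apply/setP => i; rewrite !mem_swap tpermK. Qed.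

Lemma swapC x y A : swap x y A = swap y x A.
Proof. by rewrite /swap tpermC. Qed.

Lemma card_swap x y A : #|swap x y A| = #|A|.
Proof. by rewrite card_preimset //; apply: perm_inj. Qed.

Lemma swap_id x y A : (x \in A) = (y \in A) -> swap x y A = A.
Proof.
by move=> xyA; apply/setP => i; rewrite mem_swap; case: tpermP => [->|->|].
Qed.

Definition endpoints l := unzip1 l ++ unzip2 l.

Lemma endpoints_cons x y l : perm_eq (endpoints ((x, y) :: l)) (x :: y :: endpoints l).
Proof. by rewrite /endpoints /= perm_cons -cat1s perm_catCA. Qed.

Lemma uniq_endpoints_cons x y l :
  uniq (endpoints ((x, y) :: l)) =
  [&& x != y, x \notin endpoints l, y \notin endpoints l & uniq (endpoints l)].
Proof. by rewrite (perm_uniq (endpoints_cons x y l)) /= inE negb_or -!andbA. Qed.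

Lemma mem_endpoints q l : q \in l -> (q.1 \in endpoints l) && (q.2 \in endpoints l).
Proof. by move=> ql; rewrite !mem_cat !map_f ?orbT. Qed.

Lemma pair_sign_cons q l B :
  pair_sign (q :: l) B = ((q.1 \in B)%:R - (q.2 \in B)%:R) * pair_sign l B.
Proof. by rewrite /pair_sign big_cons. Qed.

Lemma pair_sign_swap_out l x y B : x \notin endpoints l -> y \notin endpoints l ->
  pair_sign l (swap x y B) = pair_sign l B.
Proof.
move=> xl yl; apply: eq_big_seq => q /mem_endpoints/andP[q1 q2].
rewrite !mem_swap !tpermD //;
  by [apply: contraNneq xl => -> | apply: contraNneq yl => ->].
Qed.

Lemma pair_sign_swap_in l q B : uniq (endpoints l) -> q \in l ->
  pair_sign l (swap q.1 q.2 B) = - pair_sign l B.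
Proof.
elim: l => // -[x y] l IH; rewrite uniq_endpoints_cons => /and4P[xy xl yl ul].
rewrite inE => /predU1P[-> | ql]; rewrite !pair_sign_cons /= !mem_swap.
  by rewrite pair_sign_swap_out // tpermL tpermR -mulNr opprB.
have /andP[q1 q2] := mem_endpoints ql.
rewrite IH // mulrN !tpermD //;
  by [apply: contraNneq xl => <- | apply: contraNneq yl => <-].
Qed.

Section Eigenfunctions.
Variable K : {set T} -> {set T} -> int.
Hypothesis Kswap : forall x y A B, K (swap x y A) (swap x y B) = K A B.
Implicit Types (v : {set T} -> algC) (d : algC).

Definition eigenfunction d v := forall A, \sum_B (K A B)%:~R * v B = d * v A.
Definition antisymmetric_on l v :=
  forall q, q \in l -> forall A, v (swap q.1 q.2 A) = - v A.
Definition symmetric_off l v :=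
  forall x y, x \notin endpoints l -> y \notin endpoints l -> forall A, v (swap x y A) = v A.

Lemma swap_disjoint x y a b A : x \notin [:: a; b] -> y \notin [:: a; b] ->
  swap x y (swap a b A) = swap a b (swap x y A).
Proof.
rewrite !inE !negb_or => /andP[xa xb] /andP[ya yb].
have com : (tperm x y * tperm a b = tperm a b * tperm x y)%g.
  have := tpermJ x y (tperm a b); rewrite !tpermD 1?eq_sym // => com.
  by rewrite -[in LHS]com conjgE tpermV -!mulgA tperm2 mulg1.
by apply/setP => i; rewrite !mem_swap -!permM com.
Qed.

Lemma eigenfunction_antisym d v x y : eigenfunction d v ->
  eigenfunction d (fun A => v A - v (swap x y A)).
Proof.
move=> ev A; rewrite mulrBr -!ev.
rewrite [X in _ = _ - X](reindex_inj (inv_inj (swapK x y))) -sumrB /=.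
by apply: eq_bigr => B _; rewrite mulrBr Kswap.
Qed.

(** As long as w changes under some transposition (x y) away from the pairs of l,
    subtract its image under (x y).  The result is nonzero, it is still an
    eigenfunction, and it is still antisymmetric for l since disjoint
    transpositions commute. *)
Lemma maximal_antisymmetric d v : eigenfunction d v -> (exists A, v A != 0) ->
  exists l w, [/\ eigenfunction d w, (exists A, w A != 0), uniq (endpoints l),
                  antisymmetric_on l w & symmetric_off l w].
Proof.
move=> ev v0.
suff H m l w : (#|T| - size l < m)%N -> eigenfunction d w -> (exists A, w A != 0) ->
    uniq (endpoints l) -> antisymmetric_on l w ->
  exists l w, [/\ eigenfunction d w, (exists A, w A != 0), uniq (endpoints l),
                  antisymmetric_on l w & symmetric_off l w].
  by apply: (H _ [::] v (leqnn _)).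
elim: m l w => // m IH l w sz ew w0 ul anti.
pose bad x y A := [&& x \notin endpoints l, y \notin endpoints l & w (swap x y A) != w A].
have [/existsP[x /existsP[y /existsP[A0 /and3P[xl yl wA0]]]] | sym] :=
    boolP [exists x, exists y, exists A, bad x y A]; last first.
  exists l, w; split=> // x y xl yl A; apply: contraNeq sym => wA.
  do 2![apply/existsP; eexists]; apply/existsP; exists A.
  by apply/and3P; split; [exact: xl|exact: yl|].
have xy : x != y by apply: contraNneq wA0 => ->; rewrite swap_id.
have ul' : uniq (endpoints ((x, y) :: l)) by rewrite uniq_endpoints_cons xy xl yl ul.
apply: (IH ((x, y) :: l) (fun A => w A - w (swap x y A))) => //.
- have := max_card (mem (endpoints ((x, y) :: l))).
  rewrite (card_uniqP ul') size_cat !size_map /=; move: sz; move: #|T| => N; lia.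
- exact: eigenfunction_antisym.
- by exists A0; rewrite subr_eq0 eq_sym.
move=> q; rewrite inE => /predU1P[-> A /=|ql A]; first by rewrite swapK opprB.
have /andP[q1 q2] := mem_endpoints ql.
rewrite swap_disjoint ?anti ?opprB 1?opprK 1?addrC //; last 2 first.
- by rewrite !inE !negb_or; apply/andP; split; apply: contraNneq xl => ->.
- by rewrite !inE !negb_or; apply/andP; split; apply: contraNneq yl => ->.
Qed.

Lemma antisymmetric_eq0 l v q B : antisymmetric_on l v -> q \in l ->
  (q.1 \in B) = (q.2 \in B) -> v B = 0.
Proof.
move=> anti ql qB; have := anti q ql B; rewrite swap_id // => /eqP.
by rewrite -addr_eq0 -mulr2n mulrn_eq0 /= => /eqP.
Qed.

Lemma pair_sign_self l A : (forall q, q \in l -> (q.1 \in A) && (q.2 \notin A)) ->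
  pair_sign l A = 1.
Proof.
move=> inA; rewrite /pair_sign big_seq big1 // => q /inA/andP[-> /negPf->].
by rewrite subr0.
Qed.

(** Transpositions carry B to A one element at a time.  At each of them v and
    [pair_sign l] change in the same way: both change sign if the transposition
    is one of l, and neither changes if it avoids l. *)
Lemma antisymmetric_determined l v A B :
  antisymmetric_on l v -> symmetric_off l v -> uniq (endpoints l) ->
  (forall q, q \in l -> (q.1 \in A) && (q.2 \notin A)) -> #|B| = #|A| ->
  v B = v A * (pair_sign l B)%:~R.
Proof.
move=> anti sym ul inA; have [m] := ubnP #|A :\: B|.
elim: m B => // m IH B AB cB.
have [/hasP[q ql /eqP qB] | split_all] :=
    boolP (has (fun q => (q.1 \in B) == (q.2 \in B)) l).
  rewrite (antisymmetric_eq0 anti ql qB) /pair_sign (big_rem q) //= qB subrr.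
  by rewrite mul0r mulr0.
have [AsubB | ] := boolP (A \subset B).
  have -> : B = A by apply/esym/eqP; rewrite eqEcard AsubB cB leqnn.
  by rewrite pair_sign_self // mulr1.
rewrite -setD_eq0 => /set0Pn[a aAB].
have [b bBA] : exists b, b \in B :\: A.
  have eqAB : #|B :\: A| = #|A :\: B|.
    by have := cardsID A B; have := cardsID B A; rewrite (setIC B A) cB; lia.
  by apply/set0Pn; rewrite -card_gt0 eqAB card_gt0; apply/set0Pn; exists a.
have closer x y : x \in A :\: B -> y \in B :\: A ->
    v (swap x y B) = v A * (pair_sign l (swap x y B))%:~R.
  move=> xAB yBA; apply: IH; last by rewrite card_swap.
  rewrite ltnS in AB; apply: leq_trans AB; apply: proper_card; apply/properP; split.
    apply/subsetP => i; move: xAB yBA; rewrite !inE => /andP[xB xA] /andP[yA yB].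
    by case: tpermP => [->|->|//]; rewrite ?xA ?xB ?(negPf yA) ?andbF.
  exists x => //; move: xAB yBA; rewrite !inE tpermL => /andP[xB xA] /andP[yA yB].
  by rewrite yB.
(* a pair of l on the wrong side is swapped first; afterwards a and b avoid l *)
have [/hasP[q ql qB] | noq] := boolP (has (fun q => q.1 \notin B) l).
  have /andP[q1A q2A] := inA q ql.
  have q2B : q.2 \in B.
    by have := hasPn split_all q ql; rewrite (negPf qB); case: (_ \in B).
  have := closer q.1 q.2; rewrite !inE qB q1A q2A q2B => /(_ isT isT).
  by rewrite anti // pair_sign_swap_in // rmorphN mulrN => /oppr_inj.
have in1 q : q \in l -> q.1 \in B by move=> ql; have := hasPn noq q ql; rewrite negbK.
have in2 q : q \in l -> q.2 \notin B.
  by move=> ql; have := hasPn split_all q ql; rewrite in1 //; case: (_ \in B).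
have out z : (z \in A) != (z \in B) -> z \notin endpoints l.
  move=> zAB; rewrite mem_cat; apply/norP; split; apply/negP => /mapP[q ql zq];
    move: zAB; rewrite zq; have /andP[q1 q2] := inA q ql.
    by rewrite q1 in1.
  by rewrite (negPf q2) (negPf (in2 q ql)).
have [al bl] : a \notin endpoints l /\ b \notin endpoints l.
  move: aAB bBA; rewrite !inE => /andP[aB aA] /andP[bA bB].
  by split; apply: out; rewrite ?aA ?(negPf aB) ?bB ?(negPf bA).
by have := closer a b aAB bBA; rewrite sym // pair_sign_swap_out.
Qed.

Definition orient A l := [seq if q.1 \in A then q else (q.2, q.1) | q <- l].

Lemma perm_orient A l : perm_eq (endpoints (orient A l)) (endpoints l).
Proof.
elim: l => // -[x y] l IH; rewrite perm_sym (permPl (endpoints_cons x y l)) perm_sym.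
rewrite /orient /=; case: ifP => _; rewrite (permPl (endpoints_cons _ _ _)) ?perm_cons //.
rewrite -(cat1s y) -(cat1s x (endpoints _)) -(cat1s x) -(cat1s y (endpoints l)).
by rewrite perm_catCA !perm_cons.
Qed.

Lemma splits_of_endpoints A l : uniq (endpoints l) ->
  (forall q, q \in l -> (q.1 \in A) && (q.2 \notin A)) -> splits A l.
Proof.
by rewrite cat_uniq => /and3P[u1 _ u2] inA; apply/and3P; split=> //; apply/allP.
Qed.

(** Evaluate the eigenvalue equation of the antisymmetrised eigenfunction at a set
    A where it does not vanish.  Such an A contains exactly one element of each
    pair, which is made the first one. *)
Lemma eigenvalue_pair_sign d v : (forall A B, #|A| != #|B| -> K A B = 0) ->
  eigenfunction d v -> (exists A, v A != 0) ->
  exists A l, [/\ uniq (endpoints l), splits A l &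
    d = (\sum_(B : {set T} | #|B| == #|A|) K A B * pair_sign l B)%:~R].
Proof.
move=> Kcard ev v0.
have [l [w [ew [A wA] ul anti sym]]] := maximal_antisymmetric ev v0.
have one q : q \in l -> (q.1 \in A) != (q.2 \in A).
  move=> ql; apply: contraNneq wA => qA.
  by rewrite (antisymmetric_eq0 anti ql qA).
have uo : uniq (endpoints (orient A l)) by rewrite (perm_uniq (perm_orient A l)).
have inA q : q \in orient A l -> (q.1 \in A) && (q.2 \notin A).
  move=> /mapP[q' /one q'A ->]; case: ifP q'A => /= [-> | q1].
    by case: (_ \in A).
  by rewrite q1; case: (_ \in A).
have antio : antisymmetric_on (orient A l) w.
  move=> q /mapP[q' q'l ->] B; case: ifP => _; first exact: anti.
  by rewrite swapC anti.
have symo : symmetric_off (orient A l) w.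
  by move=> x y; rewrite !(perm_mem (perm_orient A l)); apply: sym.
exists A, (orient A l); split=> //; first exact: splits_of_endpoints.
apply: (mulIf wA); rewrite -ew rmorph_sum mulr_suml /= [RHS]big_mkcond /=.
apply: eq_bigr => B _; case: eqVneq => [cB|cB].
  by rewrite (antisymmetric_determined antio symo uo inA cB) rmorphM mulrCA mulrC.
by rewrite Kcard ?mul0r // eq_sym.
Qed.

End Eigenfunctions.

Lemma psd_of_pair_sums (K : {set T} -> {set T} -> int) :
  (forall A B, K A B = K B A) ->
  (forall x y A B, K (swap x y A) (swap x y B) = K A B) ->
  (forall A B, #|A| != #|B| -> K A B = 0) ->
  (forall A l, uniq (endpoints l) -> splits A l ->
     0 <= \sum_(B : {set T} | #|B| == #|A|) K A B * pair_sign l B) ->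
  forall f : {set T} -> int, 0 <= \sum_A \sum_B f A * K A B * f B.
Proof.
move=> Ksym Kswap Kcard Kpair; apply: psd_of_eigenvalues Ksym _ => v d v0 ev.
have [A [l [ul spl ->]]] := eigenvalue_pair_sign Kswap Kcard ev v0.
by rewrite ler0z Kpair.
Qed.

End Swaps.

(** * The bound on the slice *)

Section Slice.
Variable T : finType.
Implicit Types (A B : {set T}) (F : {set {set T}}).

Lemma overlap_sym k A B : #|A| = k.*2 -> #|B| = k.*2 ->
  overlap k k A B = (#|A :&: B| == k).
Proof.
move=> Ak Bk; rewrite /overlap; case: eqP => //= AB.
by have := cardsID A B; rewrite setIC AB Bk; lia.
Qed.

Lemma card_overlap k A : #|A| = k.*2 ->
  #|[set B | overlap k k A B]| = ('C(k.*2, k) * 'C(#|~: A|, k))%N.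
Proof.
move=> Ak; have := sum_overlap_sign A set0 k k.
rewrite !setI0 !setD0 cards0 !kraw0 Ak.
under eq_bigr => B _ do rewrite setI0 cards0 expr0.
move/eqP; rewrite sumr_const natz -PoszM eqz_nat => /eqP <-.
by rewrite cardsE.
Qed.

Lemma sum_pair_sign_slice p l c : uniq (endpoints (p :: l)) ->
  \sum_(B : {set T} | #|B| == c) pair_sign (p :: l) B = 0.
Proof.
move=> ul; set S := \sum_(B | _) _.
suff : S = - S by lia.
rewrite {1}/S (reindex_inj (inv_inj (swapK p.1 p.2))) /= -sumrN.
apply: eq_big => [B|B _]; first by rewrite card_swap.
by rewrite pair_sign_swap_in ?mem_head.
Qed.

(** The kernel K below is, up to scaling, the adjacency matrix of the overlap graph
    plus [kraw_bound] / 2 times the identity, with the constants projected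
    out.  Multiplying by N and 2 keeps it integral. *)
Lemma overlap_hoffman k m F : #|T| = (k.*2 + m)%N -> (k <= m < k.*2)%N ->
  (forall A, A \in F -> #|A| = k.*2) ->
  (2 * ('C(k.*2, k) * 'C(m, k))%:Z + kraw_bound k m) * #|F|%:Z ^+ 2 <=
  'C(#|T|, k.*2)%:Z *
  (2 * \sum_(A in F) #|[set B in F | overlap k k A B]|%:Z + kraw_bound k m * #|F|%:Z).
Proof.
move=> Tkm km Fk.
have cC A : #|A| = k.*2 -> #|~: A| = m by have := cardsC A; lia.
set N := 'C(#|T|, k.*2)%:Z; set d := ('C(k.*2, k) * 'C(m, k))%:Z.
set b := kraw_bound k m.
pose K A B : int := if (#|A| == k.*2) && (#|B| == k.*2) then
    N * (2 * (overlap k k A B)%:R + b * (A == B)%:R) - (2 * d + b) else 0.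
have sliceN : \sum_(B : {set T} | #|B| == k.*2) 1 = N :> int.
  by rewrite sumr_const natz /N -card_draws cardsE.
have K_ge0 : forall f : {set T} -> int, 0 <= \sum_A \sum_B f A * K A B * f B.
  apply: psd_of_pair_sums => [A B|x y A B|A B AB|A l ul spl].
  - rewrite /K andbC; case: ifP => // /andP[/eqP Ak /eqP Bk].
    by rewrite !overlap_sym // setIC [A == B]eq_sym.
  - rewrite /K !card_swap; case: ifP => // _.
    rewrite /overlap /swap -preimsetI -preimsetD !card_preimset; try exact: perm_inj.
    by rewrite (inj_eq (inv_inj (swapK x y))).
  - rewrite /K; case: ifP => // /andP[/eqP Ak /eqP Bk].
    by rewrite Ak Bk eqxx in AB.
  have [Ak|Ak] := eqVneq #|A| k.*2; last first.
    by rewrite big1 // => B _; rewrite /K (negPf Ak) mul0r.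
  have -> : \sum_(B : {set T} | #|B| == #|A|) K A B * pair_sign l B =
      N * (2 * sign_sum k A set0 l + b * pair_sign l A) -
      (2 * d + b) * \sum_(B : {set T} | #|B| == k.*2) pair_sign l B.
    have e1 : \sum_(B : {set T} | #|B| == k.*2) (overlap k k A B)%:R * pair_sign l B
        = sign_sum k A set0 l.
      rewrite /sign_sum [LHS]big_mkcond [RHS]big_mkcond; apply: eq_bigr => B _.
      rewrite setI0 cards0 expr0 mul1r; case: ifPn => cB.
        by case: ifP => _; rewrite ?mul1r ?mul0r.
      case: ifPn => // /andP[/eqP AB /eqP BA]; case/eqP: cB.
      by rewrite -(cardsID A B) setIC AB BA addnn.
    have e2 : \sum_(B : {set T} | #|B| == k.*2) (A == B)%:R * pair_sign l B =
        pair_sign l A.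
      rewrite (bigD1 A) ?Ak //= eqxx mul1r big1 ?addr0 // => B /andP[_ BA].
      by rewrite eq_sym (negPf BA) mul0r.
    rewrite -e1 -e2 !mulr_sumr -big_split /= mulr_sumr -sumrB Ak.
    by apply: eq_bigr => B cB; rewrite /K Ak eqxx cB /=; ring.
  case: l ul spl => [|p l] ul spl.
    rewrite sign_sum_nil !setI0 !setD0 cards0 !kraw0 Ak cC // /pair_sign big_nil.
    under eq_bigr => B _ do rewrite big_nil.
    rewrite sliceN; lia.
  rewrite sum_pair_sign_slice // mulr0 subr0 mulr_ge0 //.
  rewrite pair_sign_self; last by case/and3P: spl => _ _ /allP.
  have := @sign_sum_ge T k A p l Ak; rewrite cC // => /(_ km spl); rewrite -/b; lia.
have := K_ge0 (fun A => (A \in F)%:R).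
have -> : \sum_A \sum_B (A \in F)%:R * K A B * (B \in F)%:R =
    N * (2 * \sum_(A in F) #|[set B in F | overlap k k A B]|%:Z + b * #|F|%:Z) -
    (2 * d + b) * #|F|%:Z ^+ 2.
  have inner A : A \in F -> \sum_B (A \in F)%:R * K A B * (B \in F)%:R =
      N * (2 * #|[set B in F | overlap k k A B]|%:Z + b) - (2 * d + b) * #|F|%:Z.
    move=> AF; have e1 : #|[set B in F | overlap k k A B]|%:Z =
        \sum_(B in F) (overlap k k A B)%:R.
      rewrite -sum1_card -natz natr_sum [RHS]big_mkcond [LHS]big_mkcond /=.
      by apply: eq_bigr => B _; rewrite inE; case: (B \in F); case: (overlap _ _ _ _).
    have e2 : \sum_(B in F) b * (A == B)%:R = b.
      rewrite (bigD1 A) //= eqxx mulr1 big1 ?addr0 // => B /andP[_ BA].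
      by rewrite eq_sym (negPf BA) mulr0.
    have e3 : \sum_(B in F) (2 * d + b) = (2 * d + b) * #|F|%:Z.
      by rewrite sumr_const -[#|F|%:Z]natz mulr_natr.
    rewrite e1 -e3 -{1}e2 !mulr_sumr -big_split /= mulr_sumr -sumrB.
    rewrite [RHS]big_mkcond /=; apply: eq_bigr => B _; rewrite AF.
    case: ifP => BF; last by rewrite mulr0.
    by rewrite /K !Fk // !eqxx /= mul1r mulr1.
  rewrite (bigID (mem F)) /= [X in _ + X]big1 => [|A /negPf AF]; last first.
    by rewrite big1 // => B _; rewrite AF !mul0r.
  have mulF (c : int) : c *+ #|F| = c * #|F|%:Z by rewrite -mulr_natr natz.
  rewrite addr0 (eq_bigr _ inner) sumrB -mulr_sumr big_split /= !sumr_const -mulr_sumr.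
  by rewrite !mulF; ring.
by rewrite subr_ge0.
Qed.
End Slice.

Lemma in_symdiff (T : finType) (A B : {set T}) i :
  (i \in symdiff A B) = (i \in A) (+) (i \in B).
Proof. by rewrite !inE; case: (i \in A); case: (i \in B). Qed.

(** The involution B -> symdiff A B acts on the neighbours of A and moves those in F
    outside F. *)
Lemma slice_link_half n k (F : {set {set 'I_n}}) A : (0 < k)%N ->
  F \subset ksubsets n k.*2 -> symdiff_triple_free F -> A \in F ->
  (2 * #|[set B in F | overlap k k A B]| <= #|[set B | overlap k k A B]|)%N.
Proof.
move=> k0 /subsetP Fk Ffree AF.
have card2k B : B \in F -> #|B| = k.*2 by move=> /Fk; rewrite inE => /eqP.
have shiftK : involutive (symdiff A).
  by move=> B; apply/setP => i; rewrite !in_symdiff addbA addbb.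
have shift_overlap B : overlap k k A B -> overlap k k A (symdiff A B).
  move=> /andP[/eqP AB /eqP BA]; have := cardsID B A; rewrite AB (card2k A) // => AB'.
  have {}AB' : #|A :\: B| = k by lia.
  apply/andP; split; apply/eqP; [rewrite -[RHS]AB'|rewrite -[RHS]BA].
  - by apply: eq_card => i; rewrite !inE; case: (i \in A); case: (i \in B).
  - by apply: eq_card => i; rewrite !inE; case: (i \in A); case: (i \in B).
set G := [set B in F | overlap k k A B].
have disj : [disjoint G & symdiff A @: G].
  rewrite disjoints_subset; apply/subsetP => B; rewrite !inE => /andP[BF oAB].
  apply/negP => /imsetP[C]; rewrite inE => /andP[CF oAC] BC.
  apply: Ffree; exists A, B, C; split=> //.
    rewrite /= !inE !andbT negb_or -andbA; move: (oAB) (oAC).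
    move=> /andP[/eqP AB /eqP BA] /andP[/eqP AC /eqP CA]; apply/and3P; split.
    - by apply: contra_eqN BA => /eqP <-; rewrite setDv cards0; lia.
    - by apply: contra_eqN CA => /eqP <-; rewrite setDv cards0; lia.
    - apply/negP => /eqP eBC; have : A = set0.
        apply/setP => i; have /setP/(_ i) := BC; rewrite -eBC in_symdiff inE.
        by case: (i \in A); case: (i \in B).
      by move=> A0; have := card2k _ AF; rewrite A0 cards0; lia.
  by apply/setP => i; rewrite BC !in_symdiff inE; case: (i \in A); case: (i \in C).
rewrite mul2n -addnn -[X in (_ + X)%N](card_imset _ (inv_inj shiftK)).
rewrite -(leq_card_setU G (symdiff A @: G)).2 in disj.
rewrite -(eqP disj); apply: subset_leq_card; rewrite subUset; apply/andP; split.
  by apply/subsetP => B; rewrite !inE => /andP[].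
by apply/subsetP => B /imsetP[C]; rewrite !inE => /andP[_ /shift_overlap oC] ->.
Qed.

(** With d the degree and b = [kraw_bound], the two estimates give
    (2d + b) |F| <= C(n, 2k) (d + b).  Multiplied by m, where m b = (2k - m) d, this
    reads n d |F| <= 2k d C(n, 2k) = n d C(n - 1, 2k - 1). *)
Lemma uniform_bound n k (F : {set {set 'I_n}}) : (0 < k)%N ->
  (3 * k <= n < 4 * k)%N ->
  F \subset ksubsets n k.*2 -> symdiff_triple_free F ->
  (#|F| <= 'C(n.-1, k.*2.-1))%N.
Proof.
move=> k0 nk Fk Ffree; pose m := (n - k.*2)%N.
have Tkm : #|'I_n| = (k.*2 + m)%N by rewrite card_ord /m; lia.
have card2k A : A \in F -> #|A| = k.*2.
  by move/subsetP: Fk => Fk /Fk; rewrite inE => /eqP.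
have km : (k <= m < k.*2)%N by rewrite /m; lia.
have n_eq : n%:Z = k.*2%:Z + m%:Z by rewrite /m; lia.
clearbody m.
have hoff := overlap_hoffman Tkm km card2k.
have links : 2 * \sum_(A in F) #|[set B in F | overlap k k A B]|%:Z <=
    ('C(k.*2, k) * 'C(m, k))%:Z * #|F|%:Z.
  rewrite mulr_sumr -[X in _ * X]natz mulr_natr -sumr_const; apply: ler_sum => A AF.
  have := slice_link_half k0 Fk Ffree AF; rewrite card_overlap; last exact: card2k.
  have -> : #|~: A| = m by have := cardsC A; rewrite (card2k A) // Tkm; lia.
  by rewrite -lez_nat PoszM.
have bE := kraw_boundE (m := m) (k := k) ltac:(lia) ltac:(lia).
have binE := mul_bin_diag n k.*2.-1.
rewrite card_ord in hoff; rewrite prednK in binE; last by lia.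
have d_gt0 : (0 < 'C(k.*2, k) * 'C(m, k))%N by rewrite muln_gt0 !bin_gt0; lia.
rewrite -PoszM in bE; move: hoff links bE d_gt0.
move: ('C(k.*2, k) * 'C(m, k))%N (kraw_bound k m) (\sum_(A in F) _) => d b s.
move=> hoff links bE d_gt0.
have [-> // | F0] := posnP #|F|.
have quad : (2 * d%:Z + b) * #|F|%:Z <= 'C(n, k.*2)%:Z * (d%:Z + b).
  rewrite -(@ler_pM2r _ #|F|%:Z) // -mulrA -expr2; apply: le_trans hoff _.
  by rewrite -mulrA; apply: ler_wpM2l => //; rewrite [leRHS]mulrDl lerD2r.
have mul_m : m%:Z * ((2 * d%:Z + b) * #|F|%:Z) = n%:Z * (d%:Z * #|F|%:Z).
  transitivity (2 * m%:Z * d%:Z * #|F|%:Z + m%:Z * b * #|F|%:Z); first by ring.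
  by rewrite bE n_eq; ring.
have mul_m' : m%:Z * ('C(n, k.*2)%:Z * (d%:Z + b)) =
    n%:Z * (d%:Z * 'C(n.-1, k.*2.-1)%:Z).
  transitivity ('C(n, k.*2)%:Z * (m%:Z * d%:Z + m%:Z * b)); first by ring.
  transitivity (d%:Z * (n * 'C(n.-1, k.*2.-1))%N%:Z); last by rewrite PoszM; ring.
  by rewrite bE binE PoszM; ring.
have : m%:Z * ((2 * d%:Z + b) * #|F|%:Z) <= m%:Z * ('C(n, k.*2)%:Z * (d%:Z + b)).
  exact: ler_wpM2l.
rewrite mul_m mul_m' !ler_pM2l //; lia.
Qed.

Lemma card_ksubsets_le n m (F : {set {set 'I_n}}) :
  F \subset ksubsets n m -> (#|F| <= 'C(n, m))%N.
Proof. by move=> /subset_leq_card; rewrite card_draws card_ord. Qed.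

Lemma star_triple_free n m (i : 'I_n) : symdiff_triple_free (star m i).
Proof.
move=> [A [B [C []]]]; rewrite !inE => /andP[_ iA] /andP[_ iB] /andP[_ iC] _.
by move=> /setP/(_ i); rewrite !in_symdiff iA iB iC inE.
Qed.

Lemma card_star n m (i : 'I_n) : (0 < m)%N -> #|star m i| = 'C(n.-1, m.-1).
Proof.
move=> m0; have := cardsID [set A : {set 'I_n} | i \in A] (ksubsets n m).
rewrite card_draws card_ord.
have -> : ksubsets n m :&: [set A : {set _} | i \in A] = star m i.
  by apply/setP => A; rewrite !inE.
have -> : ksubsets n m :\: [set A : {set _} | i \in A] =
    [set A : {set 'I_n} | A \subset [set~ i] & #|A| == m].
  apply/setP => A; rewrite !inE; congr (_ && _).
  by rewrite subsetC sub1set inE.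
rewrite cards_draws cardsC1 card_ord.
case: n i => [[] //|n] i; case: m m0 => // m _.
by rewrite binS addnC => /addnI.
Qed.

(* Two side conditions delimit the bounds, which fail without them.
   - If 2k < n < 3k, no three distinct 2k-subsets have empty symmetric
     difference, so the family of all 2k-subsets exceeds the bound.
   - The zero vector lies in no zero-sum triple of distinct vectors, so adding
     it to a dictator exceeds the bound when p < 1. *)
Theorem theorem1p5 :
  (forall (n k : nat) (hn : (0 < n)%N), (n <= 4 * k - 1)%N ->
     (~~ (2 * k < n < 3 * k)%N ->
      forall F : {set {set 'I_n}},
        F \subset ksubsets n (2 * k) ->
        symdiff_triple_free F ->
        (#|F| <= 'C(n - 1, 2 * k - 1))%N)
     /\ [/\ star (2 * k) (Ordinal hn) \subset ksubsets n (2 * k),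
            symdiff_triple_free (star (2 * k) (Ordinal hn))
          & #|star (2 * k) (Ordinal hn)| = 'C(n - 1, 2 * k - 1)])
  /\
  (forall (R : realFieldType) (p : R) (n : nat) (hn : (0 < n)%N),
     1 / 2%:R <= p -> p <= 2%:R / 3%:R ->
     (forall F : {set 'rV['F_2]_n},
        0 \notin F ->
        zero_sum_triple_free F ->
        biased_measure p F <= p)
     /\ [/\ 0 \notin dictator (Ordinal hn),
            zero_sum_triple_free (dictator (Ordinal hn))
          & biased_measure p (dictator (Ordinal hn)) = p]).
Proof.
split=> [n k hn nk|R p n hn p_ge p_le]; last first.
  split=> [F|]; first exact: biased_bound.
  by split; [exact: dictator_notin0|exact: dictator_triple_free|exact: dictator_measure].
have k0 : (0 < k)%N by lia.
rewrite !mul2n !subn1; split=> [range F Fk Ffree|]; last first.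
  split; [|exact: star_triple_free|by rewrite card_star // double_gt0].
  by apply/subsetP => A; rewrite inE => /andP[].
have [n_le|n_gt] := leqP n k.*2; last first.
  by apply: uniform_bound => //; move: range nk n_gt; clear; lia.
apply: leq_trans (card_ksubsets_le Fk) _.
case: n k.*2 {Fk Ffree range F nk} n_le hn (double_gt0 k) => // n [|m] // nm _ _.
by rewrite binS bin_small.
Qed.
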